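(* Let $a_0,b_0,c\in\mathbb{R}$ with $a_0b_0>0$, and suppose that $u=u(t)$ satisfies $$u''=\exp(-a_0u'+b_0t+c)\qquad\text{on } \mathbb{R}.$$ Suppose there exists $t_0\in\mathbb{R}$ such that $u(t_0+t)=u(t_0-t)$ for each $t\in\mathbb{R}$. Then $$u(t)=\frac{b_0}{2a_0}(t-t_0)^2+\min_{\mathbb{R}}u\qquad\text{for all } t\in\mathbb{R}.$$
   Context: Here $u:\mathbb{R}\to\mathbb{R}$ is a classical (twice differentiable) solution of the ordinary differential equation on all of $\mathbb{R}$. *)

(* Defs.v *)
From Stdlib Require Import Reals.
From Coquelicot Require Import Coquelicot.
Open Scope R_scope.

(* The minimum is attained, so this is stronger than m being the infimum of u;
   such an m is unique. *)
Definition is_global_min (u : R -> R) (m : R) : Prop :=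
  (exists t : R, u t = m) /\ (forall t : R, m <= u t).

(* [ex_derive_n u 2 t] alone only says that the total function [Derive u] is
   differentiable at t, hence the separate first-order condition. *)
Definition twice_differentiable (u : R -> R) : Prop :=
  (forall t : R, ex_derive u t) /\ (forall t : R, ex_derive_n u 2 t).

(* Main.v *)
(** Put v = u'. The equation separates: exp (a0 v) - (a0 / b0) exp (b0 t + c) is a
    constant K. The symmetry of u makes v odd about t0, so the values of exp (a0 v)
    at t0 + s and t0 - s are inverse to each other. Comparing s = 0 with s = 1
    forces K = 0, hence v is affine and u is a parabola. *)
Require Import Defs.
From Stdlib Require Import Reals Lra.
From Coquelicot Require Import Coquelicot.
Open Scope R_scope.

Lemma is_derive_zero_const (f : R -> R) :
  (forall t, is_derive f t 0) -> forall x y, f x = f y.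
Proof.
intros Hf x y.
destruct (MVT_gen f x y (fun _ => 0)) as [z [_ Hz]].
- intros t _; apply Hf.
- intros t _; apply continuity_pt_filterlim, (ex_derive_continuous f).
  exists 0; apply Hf.
- lra.
Qed.

(** Both sides of the symmetry are the same function of the offset, and the chain rule computes its
    derivative at [s] in two ways. *)
Lemma Derive_reflect_odd (u : R -> R) (t0 : R) :
  (forall t, ex_derive u t) -> (forall t, u (t0 + t) = u (t0 - t)) ->
  forall s, Derive u (t0 - s) = - Derive u (t0 + s).
Proof.
intros Hu Hsym s.
assert (H1 : is_derive (fun r => u (t0 + r)) s (Derive u (t0 + s))).
{ auto_derive; [apply Hu | apply Rmult_1_l]. }
assert (H2 : is_derive (fun r => u (t0 + r)) s (- Derive u (t0 - s))).
{ apply (is_derive_ext (fun r => u (t0 - r))).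
  - intros r; symmetry; apply Hsym.
  - auto_derive; [apply Hu |].
    change (-(1) * Derive u (t0 - s) = - Derive u (t0 - s)); ring. }
apply is_derive_unique in H1; apply is_derive_unique in H2; lra.
Qed.

(** Multiplying the equation by [a * exp (a * v t)] cancels [v] on the right: the derivative of
    [exp (a * v t)] is [a * exp (b * t + c)], which integrates explicitly since [b] is nonzero. *)
Lemma ode_first_integral (a b c : R) (v : R -> R) :
  b <> 0 ->
  (forall t, is_derive v t (exp (- a * v t + b * t + c))) ->
  exists K, forall t, exp (a * v t) = a / b * exp (b * t + c) + K.
Proof.
intros Hb Hv.
set (E := fun t => exp (a * v t) - a / b * exp (b * t + c)).
assert (HE : forall t, is_derive E t 0).
{ intros t; unfold E; auto_derive.
  - eexists; apply Hv.
  - change (Derive (fun x => v x) t) with (Derive v t).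
    rewrite (is_derive_unique _ _ _ (Hv t)).
    replace (b * t + c) with (a * v t + (- a * v t + b * t + c)) by ring.
    rewrite (exp_plus (a * v t)); field; exact Hb. }
exists (E 0); intros t.
rewrite <- (is_derive_zero_const E HE t 0); unfold E; ring.
Qed.

(** Subtracting [(k + K) ^ 2 = 1] from the product leaves [k * K * (x + / x - 2)], that is
    [k * K * (x - 1) ^ 2 / x], where only [K] can vanish. *)
Lemma inverse_pair_rigid (k K x : R) :
  k <> 0 -> x <> 0 -> x <> 1 ->
  k + K = 1 -> (k * x + K) * (k * / x + K) = 1 -> K = 0.
Proof.
intros Hk Hx Hx1 Hs Hp.
assert (H : k * K * (x - 1) ^ 2 = 0).
{ transitivity (x * ((k * x + K) * (k * / x + K) - (k + K) ^ 2)).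
  - field; exact Hx.
  - rewrite Hp, Hs; ring. }
apply Rmult_integral in H; destruct H as [H | H].
- apply Rmult_integral in H; tauto.
- exfalso; apply (pow_nonzero (x - 1) 2); [lra | exact H].
Qed.

Lemma odd_solution_affine (a b c t0 : R) (v : R -> R) :
  0 < a * b ->
  (forall t, is_derive v t (exp (- a * v t + b * t + c))) ->
  (forall s, v (t0 - s) = - v (t0 + s)) ->
  forall t, v t = b / a * (t - t0).
Proof.
intros Hab Hv Hodd t.
assert (Ha : a <> 0) by (intros ->; lra).
assert (Hb : b <> 0) by (intros ->; lra).
destruct (ode_first_integral a b c v Hb Hv) as [K HK].
(* Recentring time at [t0] absorbs the constant part of the exponent into [k]. *)
set (k := a / b * exp (b * t0 + c)).
assert (HK' : forall s, exp (a * v (t0 + s)) = k * exp (b * s) + K).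
{ intros s; rewrite HK; unfold k.
  replace (b * (t0 + s) + c) with (b * t0 + c + b * s) by ring.
  rewrite exp_plus; ring. }
assert (Hk : k <> 0).
{ apply Rmult_integral_contrapositive_currified.
  - apply Rmult_integral_contrapositive_currified;
      [exact Ha | apply Rinv_neq_0_compat, Hb].
  - apply Rgt_not_eq, exp_pos. }
(* Oddness at [s = 0] forces [v t0 = 0]. *)
assert (Hs : k + K = 1).
{ assert (H0 : v (t0 + 0) = 0).
  { generalize (Hodd 0); rewrite Rminus_0_r, Rplus_0_r; lra. }
  generalize (HK' 0); rewrite H0, !Rmult_0_r, exp_0; lra. }
assert (HK0 : K = 0).
(* The offsets 1 and -1 supply the inverse pair; [exp b] differs from 1 because [b] is nonzero. *)
{ apply (inverse_pair_rigid k K (exp b)); trivial.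
  - apply Rgt_not_eq, exp_pos.
  - rewrite <- exp_0; intros H; apply Hb, exp_inv, H.
  - generalize (HK' 1) (HK' (-1)).
    replace (b * -1) with (- b) by ring; rewrite Rmult_1_r, exp_Ropp.
    intros <- <-; rewrite <- exp_plus.
    replace (t0 + -1) with (t0 - 1) by ring; rewrite Hodd.
    rewrite <- exp_0; f_equal; ring. }
(* With [K = 0] and [k = 1], only injectivity of the exponential is left to use. *)
assert (Hav : a * v t = b * (t - t0)).
{ apply exp_inv; generalize (HK' (t - t0)).
  replace (t0 + (t - t0)) with t by ring; intros ->.
  replace k with 1 by lra; rewrite HK0; ring. }
apply (Rmult_eq_reg_l a); [rewrite Hav; field; exact Ha | exact Ha].
Qed.

Theorem corollary1p1 (a0 b0 c : R) (u : R -> R)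
  (hab : 0 < a0 * b0)
  (hu : twice_differentiable u)
  (hode : forall t : R, Derive_n u 2 t = exp (- a0 * Derive u t + b0 * t + c))
  (t0 : R)
  (hsym : forall t : R, u (t0 + t) = u (t0 - t)) :
  exists m : R, is_global_min u m /\
    (forall t : R, u t = b0 / (2 * a0) * (t - t0) ^ 2 + m).
Proof.
destruct hu as [hu1 hu2].
assert (Ha : a0 <> 0) by (intros ->; lra).
assert (Hv : forall t, is_derive (Derive u) t
                         (exp (- a0 * Derive u t + b0 * t + c))).
{ intros t; rewrite <- hode; apply Derive_correct, hu2. }
assert (Haff := odd_solution_affine a0 b0 c t0 (Derive u) hab Hv
                  (Derive_reflect_odd u t0 hu1 hsym)).
assert (Hu : forall t, u t = b0 / (2 * a0) * (t - t0) ^ 2 + u t0).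
{ intros t.
  set (g := fun t => u t - b0 / (2 * a0) * (t - t0) ^ 2).
  assert (Hg : forall t, is_derive g t 0).
  { intros s; unfold g; auto_derive; [apply hu1 |].
    change (Derive (fun x => u x) s) with (Derive u s).
    rewrite (Haff s); field; exact Ha. }
  generalize (is_derive_zero_const g Hg t t0); unfold g.
  replace (t0 - t0) with 0 by ring; lra. }
(* The leading coefficient has the sign of [a0 * b0], so the parabola opens upwards and its minimum
   is the vertex value [u t0]. *)
assert (Hpos : 0 < b0 / (2 * a0)).
{ replace (b0 / (2 * a0)) with (a0 * b0 / (2 * a0 ^ 2)) by (field; exact Ha).
  apply Rdiv_lt_0_compat; [exact hab |].
  generalize (pow2_gt_0 a0 Ha); lra. }
exists (u t0); split; [split | exact Hu].
- now exists t0.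
- intros t; rewrite (Hu t).
  generalize (Rmult_le_pos _ _ (Rlt_le _ _ Hpos) (pow2_ge_0 (t - t0))); lra.
Qed.
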